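(* Let $t,x\in\mathbb{C}$, let $\gamma>0$ with $|x| \le e^{-\gamma}$, and let $N$ be an integer with $N > [\log(1+|t|)]/\gamma$. Then: (a) $$\Delta_N \equiv \left| \sum_{n=N}^{\infty} a_n \right| \;\le\; |a_{N-1}| \, \frac{|t| e^{-N\gamma}}{1 - (1+|t|)e^{-N\gamma}} .$$ (b) If $S_N \neq 0$, $$\delta'_N \equiv \frac{\left| \sum_{n=N}^{\infty} a_n \right|}{|S_N|} \;\le\; \frac{|a_{N-1}|}{|S_N|} \, \frac{|t| e^{-N\gamma}}{1 - (1+|t|)e^{-N\gamma}} .$$ In particular, if $N \ge [\log(1+2|t|)]/\gamma$, then $\Delta_N \le |a_{N-1}|$ and (when $S_N\ne 0$) $\delta'_N \le |a_{N-1}|/|S_N|$.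
   Context: For complex $t$ and $x$ with $|x|<1$ and integers $n\ge 0$, define $$a_n = \frac{(-t)^n x^{n(n+1)/2}}{(1-x)(1-x^2)\cdots(1-x^n)}$$ (with $a_0=1$), and let $S_N = \sum_{n=0}^{N-1} a_n$. (By Euler's identity $\sum_{n=0}^\infty a_n = \prod_{n=1}^\infty(1-tx^n)$.) Note that the hypothesis on $N$ forces $N\ge 1$. *)

(* Defs.v *)
From Stdlib Require Import Reals.
From Coquelicot Require Import Coquelicot.
Open Scope R_scope.

(* $(1-x)(1-x^2)\cdots(1-x^n)$ *)
Fixpoint qfact (x : C) (n : nat) : C :=
  match n with
  | O => RtoC 1
  | S m => (qfact x m * (RtoC 1 - x ^ S m))%C
  end.

Definition acoef (t x : C) (n : nat) : C :=
  ((- t) ^ n * x ^ (n * (n + 1) / 2)%nat / qfact x n)%C.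

(* [sum_n u M] has the M + 1 terms u 0, ..., u M, whence the shift. *)
Definition Ssum (t x : C) (N : nat) : C :=
  match N with
  | O => RtoC 0
  | S M => sum_n (acoef t x) M
  end.

(* Complex counterpart of Coquelicot's [Series] (which is real-valued): the
   limit of the partial sums, with an unspecified value for a divergent
   series; see [is_series_CSeries]. *)
Definition CSeries (u : nat -> C) : C :=
  @iota (CompleteNormedModule.CompleteSpace C_AbsRing C_CompleteNormedModule)
    (is_series u).

Lemma is_series_CSeries (u : nat -> C) (l : C) :
  is_series u l -> CSeries u = l.
Proof.
intros Hl.
exact (@iota_filterlim_locally C_AbsRing C_CompleteNormedModule nat eventually
         _ (sum_n u) l Hl).
Qed.

Definition tail_terms (t x : C) (N : nat) : nat -> C :=
  fun k => acoef t x (N + k).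

Definition DeltaN (t x : C) (N : nat) : R :=
  Cmod (CSeries (tail_terms t x N)).

Definition deltaN' (t x : C) (N : nat) : R :=
  DeltaN t x N / Cmod (Ssum t x N).

(* Main.v *)
Require Import Defs.
From Stdlib Require Import Reals Lra Lia.
From Coquelicot Require Import Coquelicot.
Open Scope R_scope.

(** Consecutive terms satisfy [a_(n+1) = a_n * (- t) x^(n+1) / (1 - x^(n+1))].
    With [E = e^(- N gamma)], every ratio from index [N - 1] on is bounded by
    [r = |t| E / (1 - E)], and the hypothesis on [N] says exactly that
    [(1 + |t|) E < 1], that is [r < 1]. The tail is thus dominated by the
    geometric series of sum
    [|a_(N-1)| r / (1 - r) = |a_(N-1)| |t| E / (1 - (1 + |t|) E)]. *)

Lemma is_series_norm_le {K : AbsRing} {V : NormedModule K}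
    (u : nat -> V) (l : V) (b : nat -> R) (L : R) :
  (forall n, norm (u n) <= b n) -> is_series b L -> is_series u l ->
  norm l <= L.
Proof.
intros Hub Hb Hu.
apply (is_lim_seq_le (fun n => norm (sum_n u n)) (sum_n b) (norm l) L).
- intros n; unfold sum_n.
  eapply Rle_trans; [apply norm_sum_n_m | apply sum_n_m_le, Hub].
- exact (filterlim_comp _ _ _ _ _ _ _ _ Hu (filterlim_norm l)).
- exact Hb.
Qed.

(** Convergence is proved along with the bound, since [CSeries] is an unspecified value for a
    divergent series and the estimate would then say nothing about a sum. *)
Lemma CSeries_geom_bound (u : nat -> C) (A r : R) :
  0 <= r < 1 -> (forall n, Cmod (u n) <= A * r ^ n) ->
  ex_series u /\ Cmod (CSeries u) <= A / (1 - r).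
Proof.
intros Hr Hu.
assert (Hgeom : is_series (fun n => A * r ^ n) (A * / (1 - r))).
{ apply (@is_series_scal_l R_AbsRing R_NormedModule A (pow r) (/ (1 - r))),
    is_series_geom.
  rewrite Rabs_pos_eq; lra. }
assert (Hex : ex_series u).
{ apply (@ex_series_le C_AbsRing C_CompleteNormedModule _ (fun n => A * r ^ n)).
  - exact Hu.
  - eexists; exact Hgeom. }
split; [exact Hex|].
destruct Hex as [l Hl]; rewrite (is_series_CSeries _ _ Hl).
exact (is_series_norm_le u l _ _ Hu Hgeom Hl).
Qed.

Lemma one_minus_neq_0 (z : C) : Cmod z < 1 -> (RtoC 1 - z)%C <> RtoC 0.
Proof.
intros Hz H0.
assert (Hz1 : z = RtoC 1) by (replace z with (1 - (1 - z))%C by ring; rewrite H0; ring).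
rewrite Hz1, Cmod_1 in Hz; lra.
Qed.

Lemma Cmod_one_minus_ge (z : C) : 1 - Cmod z <= Cmod (RtoC 1 - z).
Proof.
pose proof (Cmod_triangle (RtoC 1 - z) z) as H.
replace (RtoC 1 - z + z)%C with (RtoC 1) in H by ring.
rewrite Cmod_1 in H; lra.
Qed.

Lemma Cmod_pow_S_lt_1 (x : C) (n : nat) : Cmod x < 1 -> Cmod (x ^ S n) < 1.
Proof.
intros Hx; rewrite Cmod_pow.
apply pow_lt_1_compat; [split; [apply Cmod_ge_0 | exact Hx] | lia].
Qed.

Lemma qfact_neq_0 (x : C) (n : nat) : Cmod x < 1 -> qfact x n <> RtoC 0.
Proof.
intros Hx; induction n as [|n IH]; cbn [qfact].
- intros H; apply RtoC_inj in H; lra.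
- apply Cmult_neq_0; [exact IH|].
  apply one_minus_neq_0, Cmod_pow_S_lt_1, Hx.
Qed.

Lemma acoef_S (t x : C) (n : nat) :
  Cmod x < 1 ->
  acoef t x (S n) =
  (acoef t x n * (- t * x ^ S n / (RtoC 1 - x ^ S n)))%C.
Proof.
intros Hx; unfold acoef; cbn [qfact].
(* The added term [S n * 2] is a multiple of 2, so it leaves the truncated division exactly, without
   any parity argument on [n * (n + 1)]. *)
assert (Htri : (S n * (S n + 1) / 2 = n * (n + 1) / 2 + S n)%nat).
{ replace (S n * (S n + 1))%nat with (n * (n + 1) + S n * 2)%nat by ring.
  apply Nat.div_add; lia. }
rewrite Htri, Cpow_add_r, (Cpow_S (- t)).
pose proof (qfact_neq_0 x n Hx) as Hq.
pose proof (one_minus_neq_0 _ (Cmod_pow_S_lt_1 x n Hx)) as Hn.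
set (y := (x ^ S n)%C) in *.
field; split; assumption.
Qed.

(** The ratio has modulus at most [|t| s / (1 - s)] with [s = |x^(n+1)|], and this increases with
    [s] on [[0, 1)], so any bound [E < 1] on [s] may replace it. *)
Lemma Cmod_acoef_S_le (t x : C) (n : nat) (E : R) :
  Cmod x < 1 -> Cmod (x ^ S n) <= E -> E < 1 ->
  Cmod (acoef t x (S n)) <= Cmod (acoef t x n) * (Cmod t * E / (1 - E)).
Proof.
intros Hx HE HE1.
rewrite acoef_S, Cmod_mult, Cmod_div, Cmod_mult, Cmod_opp
  by auto using one_minus_neq_0, Cmod_pow_S_lt_1.
pose proof (Cmod_one_minus_ge (x ^ S n)) as Hge.
pose proof (Cmod_ge_0 t); pose proof (Cmod_ge_0 (x ^ S n)).
apply Rmult_le_compat_l; [apply Cmod_ge_0|].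
apply Rmult_le_compat.
- apply Rmult_le_pos; assumption.
- left; apply Rinv_0_lt_compat; lra.
- apply Rmult_le_compat_l; assumption.
- apply Rinv_le_contravar; lra.
Qed.

(** Higher powers of [x] are smaller still, so one [E] bounds all later ratios. The extra ratio in
    front of the power is the step from [a_n] to the first tail term [a_(n+1)]. *)
Lemma Cmod_acoef_add_le (t x : C) (n : nat) (E : R) :
  Cmod x < 1 -> Cmod (x ^ S n) <= E -> E < 1 ->
  forall k, Cmod (acoef t x (S n + k)) <=
    Cmod (acoef t x n) * (Cmod t * E / (1 - E)) * (Cmod t * E / (1 - E)) ^ k.
Proof.
intros Hx HE HE1 k.
pose proof (Cmod_ge_0 (x ^ S n)) as HE0.
assert (Hr : 0 <= Cmod t * E / (1 - E)).
{ apply Rdiv_le_0_compat; [apply Rmult_le_pos; [apply Cmod_ge_0|]|]; lra. }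
induction k as [|k IH].
- rewrite Nat.add_0_r, Rmult_1_r; apply Cmod_acoef_S_le; assumption.
- rewrite Nat.add_succ_r.
  eapply Rle_trans.
  + apply Cmod_acoef_S_le with (E := E); [exact Hx| |exact HE1].
    replace (S (S n + k)) with (S n + S k)%nat by lia.
    rewrite Cpow_add_r, Cmod_mult.
    pose proof (Cmod_pow_S_lt_1 x k Hx); pose proof (Cmod_ge_0 (x ^ S k)); nra.
  + rewrite <- tech_pow_Rmult.
    apply Rmult_le_compat_r with (r := Cmod t * E / (1 - E)) in IH; [|exact Hr].
    lra.
Qed.

Lemma DeltaN_le (t x : C) (n : nat) (E : R) :
  Cmod x < 1 -> Cmod (x ^ S n) <= E -> (1 + Cmod t) * E < 1 ->
  ex_series (tail_terms t x (S n)) /\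
  DeltaN t x (S n) <=
    Cmod (acoef t x n) * (Cmod t * E / (1 - (1 + Cmod t) * E)).
Proof.
intros Hx HE HtE.
pose proof (Cmod_ge_0 (x ^ S n)) as HE0.
pose proof (Cmod_ge_0 t) as Ht.
assert (HE1 : E < 1) by nra.
assert (Hr : 0 <= Cmod t * E / (1 - E) < 1).
{ split.
  - apply Rdiv_le_0_compat; nra.
  (* The inequality [|t| E < 1 - E] is [HtE] rearranged. *)
  - apply (proj1 (Rdiv_lt_1 _ (1 - E) ltac:(lra))); lra. }
destruct (CSeries_geom_bound _ _ _ Hr (Cmod_acoef_add_le t x n E Hx HE HE1))
  as [Hex Hle].
split; [exact Hex|].
eapply Rle_trans; [exact Hle|].
right; field; lra.
Qed.

Lemma Cmod_pow_le_exp (x : C) (gamma : R) (n : nat) :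
  Cmod x <= exp (- gamma) -> Cmod (x ^ n) <= exp (- (INR n * gamma)).
Proof.
intros Hx; rewrite Cmod_pow.
replace (- (INR n * gamma)) with (INR n * - gamma) by ring.
(* Writing the exponent as [n * ln (exp (- gamma))] exposes an [Rpower], which for natural [n] is
   the ordinary power of [exp (- gamma)]. *)
rewrite <- (ln_exp (- gamma)) at 1.
fold (Rpower (exp (- gamma)) (INR n)); rewrite Rpower_pow by apply exp_pos.
apply pow_incr; split; [apply Cmod_ge_0 | exact Hx].
Qed.

(** Frees the lower bounds on [N] from logarithms: this form serves [a = 1 + 2|t|], the strict one
    below [a = 1 + |t|]. *)
Lemma mult_exp_opp_le_1 (a gamma y : R) :
  0 < a -> 0 < gamma -> ln a / gamma <= y -> a * exp (- (y * gamma)) <= 1.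
Proof.
intros Ha Hg Hy.
apply Rle_div_l in Hy; [|exact Hg].
rewrite <- (exp_ln a) at 1 by exact Ha.
rewrite <- exp_plus, <- exp_0.
apply Rnot_lt_le; intros Hlt; apply exp_lt_inv in Hlt; lra.
Qed.

Lemma mult_exp_opp_lt_1 (a gamma y : R) :
  0 < a -> 0 < gamma -> ln a / gamma < y -> a * exp (- (y * gamma)) < 1.
Proof.
intros Ha Hg Hy.
apply Rlt_div_l in Hy; [|exact Hg].
rewrite <- (exp_ln a) at 1 by exact Ha.
rewrite <- exp_plus, <- exp_0.
apply exp_increasing; lra.
Qed.

Theorem proposition3p6 :
  forall (t x : C) (gamma : R) (N : nat),
    0 < gamma ->
    Cmod x <= exp (- gamma) ->
    INR N > ln (1 + Cmod t) / gamma ->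
    ex_series (tail_terms t x N) /\
    DeltaN t x N <=
      Cmod (acoef t x (N - 1)) *
      (Cmod t * exp (- (INR N * gamma)) /
       (1 - (1 + Cmod t) * exp (- (INR N * gamma)))) /\
    (Ssum t x N <> RtoC 0 ->
      deltaN' t x N <=
        Cmod (acoef t x (N - 1)) / Cmod (Ssum t x N) *
        (Cmod t * exp (- (INR N * gamma)) /
         (1 - (1 + Cmod t) * exp (- (INR N * gamma))))) /\
    (INR N >= ln (1 + 2 * Cmod t) / gamma ->
      DeltaN t x N <= Cmod (acoef t x (N - 1)) /\
      (Ssum t x N <> RtoC 0 ->
        deltaN' t x N <= Cmod (acoef t x (N - 1)) / Cmod (Ssum t x N))).
Proof.
intros t x gamma N Hg Hx HN.
pose proof (Cmod_ge_0 t) as Ht.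
assert (HtE := mult_exp_opp_lt_1 (1 + Cmod t) gamma (INR N) ltac:(lra) Hg HN).
destruct N as [|n].
(* For [N = 0] the exponential is 1 and [HtE] would read [1 + |t| < 1]; hence [N - 1] is a true
   predecessor. *)
{ rewrite Rmult_0_l, Ropp_0, exp_0 in HtE; lra. }
assert (Hx1 : Cmod x < 1).
{ eapply Rle_lt_trans; [exact Hx|].
  rewrite <- exp_0; apply exp_increasing; lra. }
pose proof (Cmod_pow_le_exp x gamma (S n) Hx) as HE.
replace (S n - 1)%nat with n by lia.
destruct (DeltaN_le t x n _ Hx1 HE HtE) as [Hex Hle].
assert (Hdiv : forall B, DeltaN t x (S n) <= B -> Ssum t x (S n) <> RtoC 0 ->
  deltaN' t x (S n) <= B / Cmod (Ssum t x (S n))).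
{ intros B HB HS.
  apply Rmult_le_compat_r; [|exact HB].
  left; apply Rinv_0_lt_compat, Cmod_gt_0, HS. }
split; [exact Hex|]; split; [exact Hle|]; split.
- intros HS.
  eapply Rle_trans; [exact (Hdiv _ Hle HS)|].
  right; unfold Rdiv; ring.
- intros HN2.
  assert (HtE2 := mult_exp_opp_le_1 (1 + 2 * Cmod t) gamma (INR (S n))
    ltac:(lra) Hg (Rge_le _ _ HN2)).
  assert (HD : DeltaN t x (S n) <= Cmod (acoef t x n)).
  { eapply Rle_trans; [exact Hle|].
    rewrite <- Rmult_1_r.
    apply Rmult_le_compat_l; [apply Cmod_ge_0|].
    (* The denominator is positive by [HtE], and the quotient is at most 1 exactly when
       [(1 + 2|t|) E <= 1], which is [HtE2]. *)
    apply Rle_div_l; lra. }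
  split; [exact HD | exact (Hdiv _ HD)].
Qed.
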